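(* Let $R$ be a subring of a ring $T$ and $A=(R:T)_r$. Then the map $\psi: R/A\longrightarrow \mathrm{End}((T/R)_R)$, where $\psi(r+A)=g_{r+A}$ and $g_{r+A}(x+R)=rx+R$ for $r\in R$, $x\in T$, is a ring monomorphism, i.e., up to ring isomorphism, $R/A$ is a subring of $\mathrm{End}((T/R)_R)$. In particular, up to ring isomorphism, $R/A$ is a subring of $\mathrm{End}_{\mathbb{Z}}(T/R)$.
   Context: Rings are associative, unital and not necessarily commutative; subrings contain the identity of the overring. $(R:T)_r:=\{x\in T\mid xT\subseteq R\}$ is the largest right ideal of $T$ contained in $R$; it is a two-sided ideal of $R$. $\mathrm{End}((T/R)_R)$ is the ring of endomorphisms of $T/R$ as a right $R$-module and $\mathrm{End}_{\mathbb{Z}}(T/R)$ is the ring of endomorphisms of $T/R$ as an abelian group; maps are written on the left and multiplication is composition. *)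

(* Defs.v *)
From HB Require Import structures.
From mathcomp Require Import all_boot all_algebra.
From mathcomp Require Import boolp.

Set Implicit Arguments.
Unset Strict Implicit.
Unset Printing Implicit Defensive.

Import GRing.Theory.

Local Open Scope ring_scope.
Local Open Scope quotient_scope.

(* Rings are [pzRingType]s: associative and unital, possibly noncommutative,
   possibly zero.  The zero ring has to be allowed: End(T/R) = 0 when R = T.
   Subsets are boolean predicates; classically (see [asbool]) this is no
   restriction. *)

Section Subring.
Variables (T : pzRingType) (R : subringClosed T).

Record subring : Type := Subring { subring_val : T; _ : subring_val \in R }.

HB.instance Definition _ := [isSub for subring_val].
HB.instance Definition _ := [Choice of subring by <:].
HB.instance Definition _ :=
  GRing.SubChoice_isSubPzRing.Build _ _ subring (subringClosedP R).

End Subring.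

(* MathComp's own ring quotients are restricted to commutative rings and proper
   ideals. *)

HB.mixin Record isMulIdeal (R : pzRingType) (I : R -> bool) := {
  mulIdealMl : forall a x, I x -> I (a * x);
  mulIdealMr : forall a x, I x -> I (x * a)
}.

#[short(type="idealClosed")]
HB.structure Definition IdealClosed (R : pzRingType) :=
  {I of isMulIdeal R I & GRing.ZmodClosed R I}.

Section RingQuotient.
Variables (R : pzRingType) (I : idealClosed R).

Definition ring_quot : Type := Quotient.quot I.

HB.instance Definition _ := GRing.Zmodule.on ring_quot.
HB.instance Definition _ := EqQuotient.on ring_quot.
HB.instance Definition _ := ZmodQuotient.on ring_quot.

Definition ring_quot_one : ring_quot := \pi_ring_quot 1.
Definition ring_quot_mul (x y : ring_quot) : ring_quot :=
  \pi_ring_quot (repr x * repr y).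

Lemma ring_quot_piE (x y : R) :
  (\pi_ring_quot x == \pi_ring_quot y) = (x - y \in I).
Proof. by rewrite -(Quotient.idealrBE I). Qed.

Lemma ring_quot_mulE (x y : R) :
  ring_quot_mul (\pi_ring_quot x) (\pi_ring_quot y) = \pi_ring_quot (x * y).
Proof.
apply/eqP; rewrite ring_quot_piE.
set x' := repr _; set y' := repr _.
have Hx : x' - x \in I by rewrite -ring_quot_piE reprK.
have Hy : y' - y \in I by rewrite -ring_quot_piE reprK.
have -> : x' * y' - x * y = x' * (y' - y) + (x' - x) * y.
  by rewrite mulrBr mulrBl addrA subrK.
by apply: rpredD; [apply: mulIdealMl | apply: mulIdealMr].
Qed.

Lemma ring_quot_piD : {morph \pi_ring_quot : x y / x + y}.
Proof. exact: pi_addr. Qed.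

Fact ring_quot_mulA : associative ring_quot_mul.
Proof.
elim/(@quotW _ ring_quot) => x; elim/(@quotW _ ring_quot) => y; elim/(@quotW _ ring_quot) => z.
by rewrite !ring_quot_mulE mulrA.
Qed.

Fact ring_quot_mul1 : left_id ring_quot_one ring_quot_mul.
Proof. by elim/(@quotW _ ring_quot) => ?; rewrite ring_quot_mulE mul1r. Qed.

Fact ring_quot_mulr1 : right_id ring_quot_one ring_quot_mul.
Proof. by elim/(@quotW _ ring_quot) => ?; rewrite ring_quot_mulE mulr1. Qed.

Fact ring_quot_mulDl : left_distributive ring_quot_mul +%R.
Proof.
elim/(@quotW _ ring_quot) => x; elim/(@quotW _ ring_quot) => y; elim/(@quotW _ ring_quot) => z.
by rewrite -ring_quot_piD !ring_quot_mulE mulrDl ring_quot_piD.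
Qed.

Fact ring_quot_mulDr : right_distributive ring_quot_mul +%R.
Proof.
elim/(@quotW _ ring_quot) => x; elim/(@quotW _ ring_quot) => y; elim/(@quotW _ ring_quot) => z.
by rewrite -ring_quot_piD !ring_quot_mulE mulrDr ring_quot_piD.
Qed.

HB.instance Definition _ := GRing.Zmodule_isPzRing.Build ring_quot
  ring_quot_mulA ring_quot_mul1 ring_quot_mulr1 ring_quot_mulDl ring_quot_mulDr.

Fact ring_quot_pi_monoid : monoid_morphism \pi_ring_quot.
Proof. by split=> // x y; rewrite -[RHS]/(ring_quot_mul _ _) ring_quot_mulE. Qed.

HB.instance Definition _ :=
  GRing.isMonoidMorphism.Build R ring_quot \pi_ring_quot ring_quot_pi_monoid.

End RingQuotient.

Section Conductor.
Variables (T : pzRingType) (R : subringClosed T).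

(* (R : T)_r *)
Definition conductor : {pred T} := [pred x | `[< forall t : T, x * t \in R >]].

Lemma conductorP (x : T) : reflect (forall t, x * t \in R) (x \in conductor).
Proof. exact: asboolP. Qed.

Lemma conductor_sub (x : T) : x \in conductor -> x \in R.
Proof. by move/conductorP/(_ 1); rewrite mulr1. Qed.

Lemma conductor_right_ideal (x t : T) : x \in conductor -> x * t \in conductor.
Proof. by move/conductorP=> xP; apply/conductorP=> u; rewrite -mulrA. Qed.

Lemma conductor_largest (J : {pred T}) :
    (forall x t, x \in J -> x * t \in J) -> {subset J <= R} ->
  {subset J <= conductor}.
Proof. by move=> JM JR x Jx; apply/conductorP=> t; apply/JR/JM. Qed.

(* Since (R : T)_r is contained in R, it is the image in T of this ideal. *)
Definition conductor_ideal : {pred subring R} := [pred r | val r \in conductor].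

Fact conductor_ideal_zmod : zmod_closed conductor_ideal.
Proof.
split=> [|x y /conductorP xP /conductorP yP]; apply/conductorP=> t.
  by rewrite mul0r rpred0.
by rewrite raddfB mulrBl rpredB.
Qed.

Fact conductor_ideal_mull (a x : subring R) :
  conductor_ideal x -> conductor_ideal (a * x).
Proof.
move/conductorP=> xP; apply/conductorP=> t.
rewrite -[_ * _]/(val a * val x * t) -mulrA.
by apply: rpredM; [apply: valP | apply: xP].
Qed.

Fact conductor_ideal_mulr (a x : subring R) :
  conductor_ideal x -> conductor_ideal (x * a).
Proof. exact: conductor_right_ideal. Qed.

HB.instance Definition _ :=
  GRing.isZmodClosed.Build (subring R) conductor_ideal conductor_ideal_zmod.
HB.instance Definition _ := isMulIdeal.Build (subring R) conductor_ideal
  conductor_ideal_mull conductor_ideal_mulr.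

End Conductor.

Arguments conductor {T} R _ : simpl never.
Arguments conductor_ideal {T} R _ : simpl never.

(* T/R as a right R-module, i.e. a left module over the converse ring R^c. *)
Section QuotientModule.
Variables (T : pzRingType) (R : subringClosed T).

Definition quot_rmod : Type := Quotient.quot R.

HB.instance Definition _ := GRing.Zmodule.on quot_rmod.
HB.instance Definition _ := EqQuotient.on quot_rmod.
HB.instance Definition _ := ZmodQuotient.on quot_rmod.

Definition quot_rmod_scale (r : (subring R)^c) (x : quot_rmod) : quot_rmod :=
  \pi_quot_rmod (repr x * val (r : subring R)).

Lemma quot_rmod_piE (x y : T) :
  (\pi_quot_rmod x == \pi_quot_rmod y) = (x - y \in R).
Proof. by rewrite -(Quotient.idealrBE R). Qed.

Lemma quot_rmod_scaleE (r : subring R) (x : T) :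
  quot_rmod_scale r (\pi_quot_rmod x) = \pi_quot_rmod (x * val r).
Proof.
apply/eqP; rewrite quot_rmod_piE -mulrBl rpredM ?(valP r) //.
by rewrite -quot_rmod_piE reprK.
Qed.

Lemma quot_rmod_piD : {morph \pi_quot_rmod : x y / x + y}.
Proof. exact: pi_addr. Qed.

Fact quot_rmod_scaleA r s x :
  quot_rmod_scale r (quot_rmod_scale s x) = quot_rmod_scale (r * s) x.
Proof. by move: x; elim/(@quotW _ quot_rmod) => x; rewrite !quot_rmod_scaleE -mulrA. Qed.

Fact quot_rmod_scale1 : left_id 1 quot_rmod_scale.
Proof. by elim/(@quotW _ quot_rmod) => ?; rewrite quot_rmod_scaleE mulr1. Qed.

Fact quot_rmod_scaleDr : right_distributive quot_rmod_scale +%R.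
Proof.
move=> r; elim/(@quotW _ quot_rmod) => x; elim/(@quotW _ quot_rmod) => y.
by rewrite -quot_rmod_piD !quot_rmod_scaleE mulrDl quot_rmod_piD.
Qed.

Fact quot_rmod_scaleDl x : {morph quot_rmod_scale^~ x : r s / r + s}.
Proof.
by move: x; elim/(@quotW _ quot_rmod) => x r s; rewrite !quot_rmod_scaleE -quot_rmod_piD -mulrDr.
Qed.

HB.instance Definition _ :=
  GRing.Zmodule_isLmodule.Build (subring R)^c quot_rmod
    quot_rmod_scaleA quot_rmod_scale1 quot_rmod_scaleDr quot_rmod_scaleDl.

End QuotientModule.

(* Maps are written on the left and multiplication is composition. *)
Section LmodEnd.
Variables (S : pzRingType) (M : lmodType S).

Definition lmodEnd : Type := {linear M -> M}.

HB.instance Definition _ := gen_eqMixin lmodEnd.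
HB.instance Definition _ := gen_choiceMixin lmodEnd.

Lemma lmodEndP (f g : lmodEnd) : f =1 g -> f = g.
Proof.
case: f g => f [[fa] [fs]] [g [[ga] [gs]]] /= /funext fg.
move: fa fs ga gs; rewrite fg => fa fs ga gs.
by rewrite (Prop_irrelevance fa ga) (Prop_irrelevance fs gs).
Qed.

Definition lmodEnd_zero : lmodEnd := \0 : {linear M -> M}.
Definition lmodEnd_opp (f : lmodEnd) : lmodEnd := \- f : {linear M -> M}.
Definition lmodEnd_add (f g : lmodEnd) : lmodEnd := f \+ g : {linear M -> M}.
Definition lmodEnd_one : lmodEnd := idfun : {linear M -> M}.
Definition lmodEnd_mul (f g : lmodEnd) : lmodEnd := f \o g : {linear M -> M}.

Fact lmodEnd_addA : associative lmodEnd_add.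
Proof. by move=> f g h; apply: lmodEndP => x /=; rewrite addrA. Qed.

Fact lmodEnd_addC : commutative lmodEnd_add.
Proof. by move=> f g; apply: lmodEndP => x /=; rewrite addrC. Qed.

Fact lmodEnd_add0 : left_id lmodEnd_zero lmodEnd_add.
Proof. by move=> f; apply: lmodEndP => x /=; rewrite add0r. Qed.

Fact lmodEnd_addN : left_inverse lmodEnd_zero lmodEnd_opp lmodEnd_add.
Proof. by move=> f; apply: lmodEndP => x /=; rewrite addNr. Qed.

HB.instance Definition _ := GRing.isZmodule.Build lmodEnd
  lmodEnd_addA lmodEnd_addC lmodEnd_add0 lmodEnd_addN.

Fact lmodEnd_mulA : associative lmodEnd_mul.
Proof. by move=> f g h; apply: lmodEndP. Qed.

Fact lmodEnd_mul1 : left_id lmodEnd_one lmodEnd_mul.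
Proof. by move=> f; apply: lmodEndP. Qed.

Fact lmodEnd_mulr1 : right_id lmodEnd_one lmodEnd_mul.
Proof. by move=> f; apply: lmodEndP. Qed.

Fact lmodEnd_mulDl : left_distributive lmodEnd_mul +%R.
Proof. by move=> f g h; apply: lmodEndP. Qed.

Fact lmodEnd_mulDr : right_distributive lmodEnd_mul +%R.
Proof. by move=> f g h; apply: lmodEndP => x /=; rewrite raddfD. Qed.

HB.instance Definition _ := GRing.Zmodule_isPzRing.Build lmodEnd
  lmodEnd_mulA lmodEnd_mul1 lmodEnd_mulr1 lmodEnd_mulDl lmodEnd_mulDr.

End LmodEnd.

Section ZmodEnd.
Variables M : zmodType.

Definition zmodEnd : Type := {additive M -> M}.

HB.instance Definition _ := gen_eqMixin zmodEnd.
HB.instance Definition _ := gen_choiceMixin zmodEnd.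

Lemma zmodEndP (f g : zmodEnd) : f =1 g -> f = g.
Proof.
case: f g => f [[fa]] [g [[ga]]] /= /funext fg.
by move: fa ga; rewrite fg => fa ga; rewrite (Prop_irrelevance fa ga).
Qed.

Definition zmodEnd_zero : zmodEnd := \0 : {additive M -> M}.
Definition zmodEnd_opp (f : zmodEnd) : zmodEnd := \- f : {additive M -> M}.
Definition zmodEnd_add (f g : zmodEnd) : zmodEnd := f \+ g : {additive M -> M}.
Definition zmodEnd_one : zmodEnd := idfun : {additive M -> M}.
Definition zmodEnd_mul (f g : zmodEnd) : zmodEnd := f \o g : {additive M -> M}.

Fact zmodEnd_addA : associative zmodEnd_add.
Proof. by move=> f g h; apply: zmodEndP => x /=; rewrite addrA. Qed.

Fact zmodEnd_addC : commutative zmodEnd_add.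
Proof. by move=> f g; apply: zmodEndP => x /=; rewrite addrC. Qed.

Fact zmodEnd_add0 : left_id zmodEnd_zero zmodEnd_add.
Proof. by move=> f; apply: zmodEndP => x /=; rewrite add0r. Qed.

Fact zmodEnd_addN : left_inverse zmodEnd_zero zmodEnd_opp zmodEnd_add.
Proof. by move=> f; apply: zmodEndP => x /=; rewrite addNr. Qed.

HB.instance Definition _ := GRing.isZmodule.Build zmodEnd
  zmodEnd_addA zmodEnd_addC zmodEnd_add0 zmodEnd_addN.

Fact zmodEnd_mulA : associative zmodEnd_mul.
Proof. by move=> f g h; apply: zmodEndP. Qed.

Fact zmodEnd_mul1 : left_id zmodEnd_one zmodEnd_mul.
Proof. by move=> f; apply: zmodEndP. Qed.

Fact zmodEnd_mulr1 : right_id zmodEnd_one zmodEnd_mul.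
Proof. by move=> f; apply: zmodEndP. Qed.

Fact zmodEnd_mulDl : left_distributive zmodEnd_mul +%R.
Proof. by move=> f g h; apply: zmodEndP. Qed.

Fact zmodEnd_mulDr : right_distributive zmodEnd_mul +%R.
Proof. by move=> f g h; apply: zmodEndP => x /=; rewrite raddfD. Qed.

HB.instance Definition _ := GRing.Zmodule_isPzRing.Build zmodEnd
  zmodEnd_mulA zmodEnd_mul1 zmodEnd_mulr1 zmodEnd_mulDl zmodEnd_mulDr.

End ZmodEnd.

(* Q is a subring of E up to ring isomorphism. *)
Definition iso_to_subring (Q E : pzRingType) : Prop :=
  exists (S : subringClosed E) (phi : {rmorphism Q -> subring S}), bijective phi.

(* Main.v *)
Require Import Defs.
From HB Require Import structures.
From mathcomp Require Import all_boot all_algebra.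
From mathcomp Require Import boolp.

Set Implicit Arguments.
Unset Strict Implicit.
Unset Printing Implicit Defensive.

Import GRing.Theory.
Local Open Scope ring_scope.
Local Open Scope quotient_scope.

(** Left multiplication by an element r of R sends R into R, hence induces an
    additive map g_r of T/R; associativity of T makes g_r linear for the right
    R-action and makes r |-> g_r a ring morphism [quot_lmul] from R to
    End((T/R)_R).  Now g_r = 0 means that r * x lies in R for all x in T, which
    is the definition of r belonging to (R : T)_r, so the kernel is the
    conductor [quot_lmul_eq0] and the morphism factors through an injection of
    R/A by the first isomorphism theorem [ring_quot_factor].

    An injective ring morphism identifies its source with its image, which is a
    subring of the target [inj_iso_to_subring].  For End_Z(T/R), the injection
    above is composed with the inclusion [lmodEnd_forget] of the R-linear
    endomorphisms into the additive ones. *)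

(** Image of a ring morphism, as a boolean predicate through classical logic. *)
Definition rmorph_img (Q E : pzRingType) (f : {rmorphism Q -> E}) : {pred E} :=
  [pred y | `[< exists x, f x = y >]].

Lemma rmorph_imgP (Q E : pzRingType) (f : {rmorphism Q -> E}) (y : E) :
  reflect (exists x, f x = y) (y \in rmorph_img f).
Proof. exact: asboolP. Qed.

Fact rmorph_img_subring (Q E : pzRingType) (f : {rmorphism Q -> E}) :
  subring_closed (rmorph_img f).
Proof.
split=> [|_ _ /rmorph_imgP[x <-] /rmorph_imgP[y <-]
         |_ _ /rmorph_imgP[x <-] /rmorph_imgP[y <-]]; apply/rmorph_imgP.
- by exists 1; rewrite rmorph1.
- by exists (x - y); rewrite rmorphB.
- by exists (x * y); rewrite rmorphM.
Qed.

HB.instance Definition _ (Q E : pzRingType) (f : {rmorphism Q -> E}) :=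
  GRing.isSubringClosed.Build E (rmorph_img f) (rmorph_img_subring f).

Lemma inj_iso_to_subring (Q E : pzRingType) (f : {rmorphism Q -> E}) :
  injective f -> iso_to_subring Q E.
Proof.
move=> f_inj.
have imf x : f x \in rmorph_img f by apply/rmorph_imgP; exists x.
pose phi x : subring (rmorph_img f) := Subring (imf x).
have phiB : zmod_morphism phi.
  by move=> x y; apply: val_inj; rewrite raddfB /= rmorphB.
have phiM : monoid_morphism phi.
  by split=> [|x y]; apply: val_inj; rewrite /= ?rmorph1 ?rmorphM.
pose phiR : {rmorphism Q -> subring (rmorph_img f)} :=
  HB.pack phi (GRing.isZmodMorphism.Build _ _ phi phiB)
    (GRing.isMonoidMorphism.Build _ _ phi phiM).
apply: ex_intro (ex_intro _ phiR _).
have preim (y : subring (rmorph_img f)) : exists x, f x = val y.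
  exact/rmorph_imgP/valP.
exists (fun y => projT1 (cid (preim y))) => [x|y].
  by apply: f_inj; case: cid.
by apply: val_inj; case: cid.
Qed.

(** First isomorphism theorem: a ring morphism with kernel [I] induces an
    injective ring morphism on the quotient by [I]. *)
Lemma ring_quot_factor (Q E : pzRingType) (I : idealClosed Q)
    (f : {rmorphism Q -> E}) :
    (forall x, (f x == 0) = (x \in I)) ->
  exists2 g : {rmorphism ring_quot I -> E},
    forall x, g (\pi_(ring_quot I) x) = f x & injective g.
Proof.
move=> kerf; pose g (q : ring_quot I) := f (repr q).
have gE x : g (\pi_(ring_quot I) x) = f x.
  by apply/eqP; rewrite -subr_eq0 -rmorphB kerf -ring_quot_piE reprK.
have gB : zmod_morphism g.
  elim/(@quotW _ (ring_quot I)) => x; elim/(@quotW _ (ring_quot I)) => y.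
  by rewrite -(raddfB \pi_(ring_quot I)) !gE rmorphB.
have gM : monoid_morphism g.
  (* The ring operations of the quotient are exposed by conversion. *)
  split; first by rewrite -[1 in LHS]/(\pi_(ring_quot I) 1) gE rmorph1.
  elim/(@quotW _ (ring_quot I)) => x; elim/(@quotW _ (ring_quot I)) => y.
  by rewrite -[_ * _ in LHS]/(ring_quot_mul _ _) ring_quot_mulE !gE rmorphM.
pose gR : {rmorphism ring_quot I -> E} :=
  HB.pack g (GRing.isZmodMorphism.Build _ _ g gB)
    (GRing.isMonoidMorphism.Build _ _ g gM).
exists gR => //.
elim/(@quotW _ (ring_quot I)) => x; elim/(@quotW _ (ring_quot I)) => y.
rewrite /= !gE => /eqP; rewrite -subr_eq0 -rmorphB kerf -ring_quot_piE.
by move/eqP.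
Qed.

Section LeftMultiplication.
Variables (T : pzRingType) (R : subringClosed T).

(** The map x + R |-> r * x + R of T/R, computed on the chosen representative
    of the coset. *)
Definition quot_lmul_fun (r : subring R) (u : quot_rmod R) : quot_rmod R :=
  \pi_(quot_rmod R) (val r * repr u).

Lemma quot_lmul_funE (r : subring R) (x : T) :
  quot_lmul_fun r (\pi_(quot_rmod R) x) = \pi_(quot_rmod R) (val r * x).
Proof.
apply/eqP; rewrite quot_rmod_piE -mulrBr rpredM ?(valP r) //.
by rewrite -quot_rmod_piE reprK.
Qed.

Fact quot_lmul_fun_zmod_morphism r : zmod_morphism (quot_lmul_fun r).
Proof.
elim/(@quotW _ (quot_rmod R)) => x; elim/(@quotW _ (quot_rmod R)) => y.
by rewrite -raddfB !quot_lmul_funE mulrBr raddfB.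
Qed.

Fact quot_lmul_fun_scalable r : scalable (quot_lmul_fun r).
Proof.
move=> s; elim/(@quotW _ (quot_rmod R)) => x.
rewrite -![_ *: _]/(quot_rmod_scale _ _).
by rewrite quot_rmod_scaleE !quot_lmul_funE quot_rmod_scaleE mulrA.
Qed.

HB.instance Definition _ r :=
  GRing.isZmodMorphism.Build (quot_rmod R) (quot_rmod R) (quot_lmul_fun r)
    (quot_lmul_fun_zmod_morphism r).
HB.instance Definition _ r :=
  GRing.isScalable.Build (subring R)^c (quot_rmod R) (quot_rmod R) *:%R
    (quot_lmul_fun r) (quot_lmul_fun_scalable r).

(** Left multiplication as an endomorphism of the right R-module T/R. *)
Definition quot_lmul (r : subring R) : lmodEnd (quot_rmod R) :=
  (quot_lmul_fun r : {linear _ -> _}).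

Fact quot_lmul_zmod_morphism : zmod_morphism quot_lmul.
Proof.
move=> r s; apply: lmodEndP; elim/(@quotW _ (quot_rmod R)) => x.
rewrite -[RHS]/(quot_lmul_fun r _ - quot_lmul_fun s _) /=.
by rewrite !quot_lmul_funE raddfB mulrBl raddfB.
Qed.

Fact quot_lmul_monoid_morphism : monoid_morphism quot_lmul.
Proof.
split=> [|r s]; apply: lmodEndP; elim/(@quotW _ (quot_rmod R)) => x /=.
  by rewrite quot_lmul_funE mul1r.
(* The inner application first: [quot_lmul_fun s _] is itself convertible to a
   class, so the formula for [r] would match it unevaluated. *)
by rewrite (quot_lmul_funE s) !quot_lmul_funE rmorphM /= mulrA.
Qed.

HB.instance Definition _ :=
  GRing.isZmodMorphism.Build (subring R) (lmodEnd (quot_rmod R)) quot_lmul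
    quot_lmul_zmod_morphism.
HB.instance Definition _ :=
  GRing.isMonoidMorphism.Build (subring R) (lmodEnd (quot_rmod R)) quot_lmul
    quot_lmul_monoid_morphism.

Lemma quot_lmul_eq0 (r : subring R) :
  (quot_lmul r == 0) = (r \in conductor_ideal R).
Proof.
have piE0 x : (\pi_(quot_rmod R) x == 0) = (x \in R).
  by rewrite -(raddf0 \pi_(quot_rmod R)) quot_rmod_piE subr0.
apply/eqP/conductorP => [r0 x|rP].
  by rewrite -piE0 -quot_lmul_funE -[quot_lmul_fun r _]/(quot_lmul r _) r0.
apply: lmodEndP; elim/(@quotW _ (quot_rmod R)) => x /=.
by rewrite quot_lmul_funE; apply/eqP; rewrite piE0.
Qed.

End LeftMultiplication.

Section Forget.
Variables (S : pzRingType) (M : lmodType S).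

(** The inclusion of the linear endomorphisms of a module into the
    endomorphisms of its underlying abelian group. *)
Definition lmodEnd_forget (f : lmodEnd M) : zmodEnd M :=
  ((f : {linear M -> M}) : {additive M -> M}).

Fact lmodEnd_forget_zmod_morphism : zmod_morphism lmodEnd_forget.
Proof. by move=> f g; apply: zmodEndP. Qed.

Fact lmodEnd_forget_monoid_morphism : monoid_morphism lmodEnd_forget.
Proof. by split=> [|f g]; apply: zmodEndP. Qed.

HB.instance Definition _ :=
  GRing.isZmodMorphism.Build (lmodEnd M) (zmodEnd M) lmodEnd_forget
    lmodEnd_forget_zmod_morphism.
HB.instance Definition _ :=
  GRing.isMonoidMorphism.Build (lmodEnd M) (zmodEnd M) lmodEnd_forget
    lmodEnd_forget_monoid_morphism.

Lemma lmodEnd_forget_inj : injective lmodEnd_forget.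
Proof.
move=> f g fg; apply: lmodEndP => x.
by rewrite -[LHS]/(lmodEnd_forget f x) fg.
Qed.

End Forget.

Theorem lemma2p16 (T : pzRingType) (R : subringClosed T) :
  (exists psi : {rmorphism ring_quot (conductor_ideal R) ->
                           lmodEnd (quot_rmod R)},
     (forall (r : subring R) (x : T),
        psi (\pi_(ring_quot (conductor_ideal R)) r) (\pi_(quot_rmod R) x)
        = \pi_(quot_rmod R) (val r * x))
     /\ injective psi)
  /\ iso_to_subring (ring_quot (conductor_ideal R)) (lmodEnd (quot_rmod R))
  /\ iso_to_subring (ring_quot (conductor_ideal R)) (zmodEnd (quot_rmod R)).
Proof.
have [psi psiE psi_inj] := ring_quot_factor (@quot_lmul_eq0 T R).
split; first by exists psi; split=> // r x; rewrite psiE; apply: quot_lmul_funE.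
split; first exact: inj_iso_to_subring psi_inj.
apply: (@inj_iso_to_subring _ _ (@lmodEnd_forget _ (quot_rmod R) \o psi)).
exact: inj_comp (@lmodEnd_forget_inj _ _) psi_inj.
Qed.
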